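(* There exists a $\mathcal{K}$-function $\xi_1$ such that for any $K\in\mathcal{G}$, $$\|\nabla\mathcal{J}_2(K)\|_F\ge\xi_1\big(\mathcal{J}_2(K)-\mathcal{J}_2(K^* )\big).$$
   Context: LQR setting: $A\in\mathbb{R}^{n\times n}$, $B\in\mathbb{R}^{n\times m}$, $Q=Q^T\succeq0$ in $\mathbb{R}^{n\times n}$, $R=R^T\succ0$ in $\mathbb{R}^{m\times m}$ are constant matrices with $(A,B)$ stabilizable and $(A,\sqrt{Q})$ observable. $\mathcal{G}=\{K\in\mathbb{R}^{m\times n}\mid A-BK\text{ is Hurwitz}\}$ is the (open) set of stabilizing gains. $P^*$ is the unique symmetric positive definite solution of $A^TP^*+P^*A+Q-P^*BR^{-1}B^TP^*=0$, and $K^*=R^{-1}B^TP^*\in\mathcal{G}$. For $K\in\mathcal{G}$, $P_K=P_K^T$ is the unique positive definite solution of $(A-BK)^TP_K+P_K(A-BK)+Q+K^TRK=0$, and $\mathcal{J}_2(K):=\mathrm{Tr}(P_K)$, whose unique minimizer on $\mathcal{G}$ is $K^*$. $\nabla\mathcal{J}_2(K)\in\mathbb{R}^{m\times n}$ is the gradient with respect to the Frobenius inner product $\langle K_1,K_2\rangle=\mathrm{Tr}(K_1^TK_2)$; explicitly $\nabla\mathcal{J}_2(K)=2(RK-B^TP_K)Y_K$, where $Y_K$ is the symmetric positive definite solution of $(A-BK)Y_K+Y_K(A-BK)^T+I_n=0$. $\|\cdot\|_F$ is the Frobenius norm. A $\mathcal{K}$-function is a function $\alpha:[0,\infty)\to[0,\infty)$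 that is continuous, strictly increasing, and vanishes at zero. *)

(* Defs.v *)
From HB Require Import structures.
From mathcomp Require Import all_boot all_order all_algebra.
From mathcomp Require Import all_classical all_reals all_analysis.
From mathcomp Require Import complex.

Set Implicit Arguments.
Unset Strict Implicit.
Unset Printing Implicit Defensive.

Import Order.TTheory GRing.Theory Num.Theory.
Import numFieldNormedType.Exports.

Local Open Scope classical_set_scope.
Local Open Scope ring_scope.

Section Matrices.
Variable F : realType.

Definition possemidef n (M : 'M[F]_n) : Prop :=
  M^T = M /\ forall x : 'cV[F]_n, 0 <= (x^T *m M *m x) 0 0.

Definition posdef n (M : 'M[F]_n) : Prop :=
  M^T = M /\ forall x : 'cV[F]_n, x != 0 -> 0 < (x^T *m M *m x) 0 0.

Definition frob_inner m n (K1 K2 : 'M[F]_(m, n)) : F := \tr (K1^T *m K2).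

Definition frob_norm m n (K : 'M[F]_(m, n)) : F := Num.sqrt (frob_inner K K).

(* Eigenvalues are taken in F[i], the complex numbers over F. *)
Definition hurwitz n (M : 'M[F]_n) : Prop :=
  forall z : F[i], eigenvalue (map_mx (real_complex F) M) z -> complex.Re z < 0.

Definition stabilizing n m (A : 'M[F]_n) (B : 'M[F]_(n, m)) : set 'M[F]_(m, n) :=
  [set K | hurwitz (A - B *m K)].

Definition stabilizable n m (A : 'M[F]_n) (B : 'M[F]_(n, m)) : Prop :=
  stabilizing A B !=set0.

(* Kalman's definition: the stacked matrix [C; CA; ...; CA^(n-1)] has rank n. *)
Definition observable n p (A : 'M[F]_n) (C : 'M[F]_(p, n)) : Prop :=
  \rank (\mxcol_(i < n) (C *m A ^+ i)) = n :> nat.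

(* Differentiability is taken for the library's (sup) norm on matrices, which
   is equivalent to the Frobenius norm. *)
Definition is_gradient m n (f : 'M[F]_(m, n) -> F) (K G : 'M[F]_(m, n)) : Prop :=
  differentiable f K /\ forall H : 'M[F]_(m, n), 'd f K H = frob_inner G H.

(* Only meaningful where [f] is differentiable; 0 elsewhere. *)
Definition gradient m n (f : 'M[F]_(m, n) -> F) (K : 'M[F]_(m, n)) :
    'M[F]_(m, n) :=
  xget 0 [set G | is_gradient f K G].

End Matrices.

Section LQR.
Variables (F : realType) (n m : nat).
Variables (A : 'M[F]_n) (B : 'M[F]_(n, m)) (Q : 'M[F]_n) (R : 'M[F]_m).

Definition are_solution (P : 'M[F]_n) : Prop :=
  posdef P /\
  A^T *m P + P *m A + Q - P *m B *m invmx R *m B^T *m P = 0.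

Definition lyap_solution (K : 'M[F]_(m, n)) (P : 'M[F]_n) : Prop :=
  posdef P /\
  (A - B *m K)^T *m P + P *m (A - B *m K) + Q + K^T *m R *m K = 0.

(* [P_K] is only meaningful for stabilizing [K], where the solution exists and
   is unique; where there is no solution it is 0. *)
Definition lyap_P (K : 'M[F]_(m, n)) : 'M[F]_n :=
  xget 0 [set P | lyap_solution K P].

Definition J2 (K : 'M[F]_(m, n)) : F := \tr (lyap_P K).

Definition opt_gain (P : 'M[F]_n) : 'M[F]_(m, n) := invmx R *m B^T *m P.

End LQR.

(* A function [0, oo) -> [0, oo) is encoded by a function on the whole of F,
   whose values on negative arguments are irrelevant. *)
Definition class_K (F : realType) (a : F -> F) : Prop :=
  [/\ forall x : F, 0 <= x -> 0 <= a x,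
      {within `[(0 : F), +oo[, continuous a},
      forall x y : F, 0 <= x -> x < y -> a x < a y
    & a 0 = 0].

(* Main.v *)
(* Let E = R K - B^T P_K, D = K* - K, X = P_K - P*, let Y solve the dual
   Lyapunov equation of A - B K, and write L_M X = M^T X + X M.  A first-order
   expansion of the Lyapunov equation gives the gradient G = 2 E Y.  Completing
   the square in L_{A - B K*} X = D^T E + E^T D + D^T R D gives
   tr X <= c |E|^2; taking the trace of the same identity then bounds |D| by
   c |E|.  Testing the equation of Y against E yields
   tr (E E^T) = - tr (E (A - B K) G^T), hence |E| <= c |A - B K| |G|, where
   |A - B K| <= a + b |E|.  So |G| >= |E| / (a' + b' |E|) up to a constant,
   which is increasing in |E| >= c (tr X)^(1/2).  It is the linear growth of D
   in E (rather than in tr X) that keeps the bound from decaying at infinity. *)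

Require Import Defs.
From HB Require Import structures.
From mathcomp Require Import all_boot all_order all_algebra.
From mathcomp Require Import all_classical all_reals all_analysis.
From mathcomp Require Import complex lra ring.

Set Implicit Arguments.
Unset Strict Implicit.
Unset Printing Implicit Defensive.

Import Order.TTheory GRing.Theory Num.Theory.
Import numFieldNormedType.Exports.

Local Open Scope ring_scope.

(** * Entrywise l1 norm *)

(** This norm is submultiplicative, invariant under transposition and dominates the trace, all by
    elementary sums. Matrix estimates are made in it; [ler_l1norm_norm] and [ler_l1norm_frob_norm]
    convert to the sup and Frobenius norms. *)
Definition l1norm (F : realType) m n (M : 'M[F]_(m, n)) : F :=
  \sum_i \sum_j `|M i j|.

Lemma l1norm_ge0 (F : realType) m n (M : 'M[F]_(m, n)) : 0 <= l1norm M.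
Proof. by apply: sumr_ge0 => i _; apply: sumr_ge0. Qed.

#[local] Hint Extern 0 (is_true (0 <= l1norm _)) => exact: l1norm_ge0 : core.

Lemma ler_entry_l1norm (F : realType) m n (M : 'M[F]_(m, n)) i j :
  `|M i j| <= l1norm M.
Proof.
rewrite /l1norm (bigD1 i) //= (bigD1 j) //= -addrA lerDl.
by apply: addr_ge0; apply: sumr_ge0 => // k _; apply: sumr_ge0.
Qed.

Lemma l1norm_le0 (F : realType) m n (M : 'M[F]_(m, n)) : l1norm M <= 0 -> M = 0.
Proof.
move=> M0; apply/matrixP => i j; rewrite mxE; apply/eqP; rewrite -normr_le0.
exact: le_trans (ler_entry_l1norm M i j) M0.
Qed.

Lemma l1norm0 (F : realType) m n : l1norm (0 : 'M[F]_(m, n)) = 0.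
Proof. by rewrite /l1norm big1 // => i _; rewrite big1 // => j _; rewrite mxE normr0. Qed.

Lemma ler_l1normD (F : realType) m n (M1 M2 : 'M[F]_(m, n)) :
  l1norm (M1 + M2) <= l1norm M1 + l1norm M2.
Proof.
rewrite /l1norm -big_split; apply: ler_sum => i _; rewrite -big_split.
by apply: ler_sum => j _; rewrite mxE; apply: ler_normD.
Qed.

Lemma l1normN (F : realType) m n (M : 'M[F]_(m, n)) : l1norm (- M) = l1norm M.
Proof. by apply: eq_bigr => i _; apply: eq_bigr => j _; rewrite mxE normrN. Qed.

Lemma ler_l1normB (F : realType) m n (M1 M2 : 'M[F]_(m, n)) :
  l1norm (M1 - M2) <= l1norm M1 + l1norm M2.
Proof. by rewrite -(l1normN M2) ler_l1normD. Qed.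

Lemma l1normZ (F : realType) m n a (M : 'M[F]_(m, n)) :
  l1norm (a *: M) = `|a| * l1norm M.
Proof.
rewrite /l1norm mulr_sumr; apply: eq_bigr => i _; rewrite mulr_sumr.
by apply: eq_bigr => j _; rewrite mxE normrM.
Qed.

Lemma l1norm_tr (F : realType) m n (M : 'M[F]_(m, n)) : l1norm M^T = l1norm M.
Proof.
rewrite /l1norm exchange_big; apply: eq_bigr => i _.
by apply: eq_bigr => j _; rewrite mxE.
Qed.

Lemma ler_l1normM (F : realType) m n p (M1 : 'M[F]_(m, n)) (M2 : 'M[F]_(n, p)) :
  l1norm (M1 *m M2) <= l1norm M1 * l1norm M2.
Proof.
rewrite /l1norm mulr_suml; apply: ler_sum => i _; rewrite mulr_suml.
apply: (@le_trans _ _ (\sum_j \sum_k `|M1 i k| * `|M2 k j|)).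
  apply: ler_sum => j _; rewrite mxE; apply: le_trans (ler_norm_sum _ _ _) _.
  by apply: ler_sum => k _; rewrite normrM.
rewrite exchange_big; apply: ler_sum => k _; rewrite -mulr_sumr ler_wpM2l //.
by rewrite [leRHS](bigD1 k) //= lerDl; apply: sumr_ge0 => l _; apply: sumr_ge0.
Qed.

Lemma ler_mxtrace_l1norm (F : realType) n (M : 'M[F]_n) : `|\tr M| <= l1norm M.
Proof.
apply: le_trans (ler_norm_sum _ _ _) _; apply: ler_sum => i _.
by rewrite (bigD1 i) //= lerDl; apply: sumr_ge0.
Qed.

Lemma l1norm_mxvec (F : realType) m n (M : 'M[F]_(m, n)) :
  l1norm (mxvec M) = l1norm M.
Proof.
rewrite /l1norm big_ord1 (reindex _ (curry_mxvec_bij _ _)) /= pair_bigA /=.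
by apply: eq_bigr => -[i j] _ /=; rewrite mxvecE.
Qed.

Lemma ler_l1norm_bound (F : realType) m n (M : 'M[F]_(m, n)) (c : F) :
  (forall i j, `|M i j| <= c) -> l1norm M <= (m * n)%:R * c.
Proof.
move=> Mc; apply: (@le_trans _ _ (\sum_(i < m) \sum_(j < n) c)).
  by apply: ler_sum => i _; apply: ler_sum.
by rewrite !sumr_const !card_ord -mulrnA mulnC mulr_natl.
Qed.

(** * Positive semidefinite matrices *)

Lemma mxtrace_congr (F : realType) m n (P : 'M[F]_m) (D : 'M[F]_(m, n)) :
  \tr (D^T *m P *m D) = \sum_j ((col j D)^T *m P *m col j D) 0 0.
Proof.
apply: eq_bigr => j _; rewrite !mxE; apply: eq_bigr => i _; rewrite !mxE.
congr (_ * _); apply: eq_bigr => k _; by rewrite !mxE.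
Qed.

Lemma mxtrace_congr_ge0 (F : realType) m n (P : 'M[F]_m) (D : 'M[F]_(m, n)) :
  possemidef P -> 0 <= \tr (D^T *m P *m D).
Proof. by case=> _ P0; rewrite mxtrace_congr; apply: sumr_ge0. Qed.

Lemma posdefW (F : realType) n (P : 'M[F]_n) : posdef P -> possemidef P.
Proof.
case=> PT P0; split=> // x; have [->|x0] := eqVneq x 0; last exact/ltW/P0.
by rewrite mulmx0 mxE.
Qed.

Lemma possemidef_congr (F : realType) m n (P : 'M[F]_m) (D : 'M[F]_(m, n)) :
  possemidef P -> possemidef (D^T *m P *m D).
Proof.
case=> PT P0; split; first by rewrite !trmx_mul trmxK PT mulmxA.
by move=> x; have := P0 (D *m x); rewrite trmx_mul !mulmxA.
Qed.

Lemma possemidefD (F : realType) n (P1 P2 : 'M[F]_n) :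
  possemidef P1 -> possemidef P2 -> possemidef (P1 + P2).
Proof.
move=> [T1 H1] [T2 H2]; split; first by rewrite linearD /= T1 T2.
by move=> x; rewrite mulmxDr mulmxDl mxE addr_ge0.
Qed.

Lemma posdefD (F : realType) n (P1 P2 : 'M[F]_n) :
  possemidef P1 -> posdef P2 -> posdef (P1 + P2).
Proof.
move=> [T1 H1] [T2 H2]; split; first by rewrite linearD /= T1 T2.
by move=> x x0; rewrite mulmxDr mulmxDl mxE ltr_wpDl // H2.
Qed.

Lemma posdefZ (F : realType) n (P : 'M[F]_n) a :
  0 < a -> posdef P -> posdef (a *: P).
Proof.
move=> a0 [T1 H1]; split; first by rewrite linearZ /= T1.
by move=> x x0; rewrite -scalemxAr -scalemxAl mxE mulr_gt0 // H1.
Qed.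

Lemma posdef1 (F : realType) n : posdef (1%:M : 'M[F]_n).
Proof.
split=> [|x x0]; first by rewrite tr_scalar_mx.
have [i xi0] : exists i, x i 0 != 0.
  apply/existsP; apply: contraNT x0; rewrite negb_exists => /forallP x0.
  by apply/eqP/matrixP => i j; rewrite mxE ord1; apply/eqP; rewrite -[_ == _]negbK x0.
rewrite mulmx1 mxE (bigD1 i) //= mxE ltr_pwDl //.
  by rewrite -expr2 exprn_even_gt0.
by apply: sumr_ge0 => k _; rewrite mxE -expr2 sqr_ge0.
Qed.

Lemma bilinear_tr (F : realType) n (P : 'M[F]_n) (x y : 'cV[F]_n) :
  P^T = P -> (y^T *m P *m x) 0 0 = (x^T *m P *m y) 0 0.
Proof.
move=> PT; rewrite -[in LHS](trmxK (y^T *m P *m x)) mxE.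
by rewrite !trmx_mul trmxK PT mulmxA.
Qed.

Lemma possemidef_CS (F : realType) n (P : 'M[F]_n) (x y : 'cV[F]_n) :
  possemidef P ->
  (x^T *m P *m y) 0 0 ^+ 2 <= (x^T *m P *m x) 0 0 * (y^T *m P *m y) 0 0.
Proof.
move=> [PT P0].
set a := (x^T *m P *m x) 0 0; set b := (x^T *m P *m y) 0 0.
set c := (y^T *m P *m y) 0 0.
have Q s t : 0 <= s ^+ 2 * a + 2 * s * t * b + t ^+ 2 * c.
  have := P0 (s *: x + t *: y).
  have -> : (s *: x + t *: y)^T = s *: x^T + t *: y^T.
    by rewrite linearD /= !linearZ.
  rewrite !mulmxDl !mulmxDr -!scalemxAl -!scalemxAr.
  rewrite ![fun_of_matrix (_ + _) _ _]mxE ![fun_of_matrix (_ *: _) _ _]mxE.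
  rewrite (bilinear_tr x y PT) -/a -/b -/c; congr (_ <= _); ring.
have a0 : 0 <= a by exact: P0.
have c0 : 0 <= c by exact: P0.
(* For c = 0 the choice s = - b, t = a + 1 yields - b^2 (a + 2) >= 0, so b = 0. Otherwise s = c, t =
   - b yields c (a c - b^2) >= 0. *)
have [c00|cN0] := eqVneq c 0.
  have := Q (- b) (a + 1); have := Q (-1) b; rewrite c00 => *; nra.
have := Q c (- b); have cp : 0 < c by rewrite lt0r cN0.
rewrite (_ : _ + _ = c * (a * c - b ^+ 2)); last by ring.
by rewrite pmulr_rge0 // subr_ge0.
Qed.

(** Cauchy-Schwarz against the basis vector e_i bounds the square of the i-th entry of P x by
    zero. *)
Lemma possemidef_ker (F : realType) n (P : 'M[F]_n) (x : 'cV[F]_n) :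
  possemidef P -> (x^T *m P *m x) 0 0 = 0 -> P *m x = 0.
Proof.
move=> Pp Px; have [PT _] := Pp; apply/matrixP => i j; rewrite ord1 [RHS]mxE {j}.
have := possemidef_CS (delta_mx i 0) x Pp; rewrite Px mulr0.
rewrite trmx_delta -mulmxA -rowE mxE => H; apply/eqP.
by rewrite -sqrf_eq0 eq_le H sqr_ge0.
Qed.

Lemma posdef_unitmx (F : realType) n (P : 'M[F]_n) : posdef P -> P \in unitmx.
Proof.
move=> [PT P0]; rewrite -unitmx_tr unitmxE unitfE; apply/negP => /det0P[v v0 vP].
have := P0 v^T; rewrite trmx_eq0 => /(_ v0); rewrite trmxK.
by rewrite -PT vP mul0mx mxE ltxx.
Qed.

(* Cauchy-Schwarz for the form P, against the vectors y i = P^-1 e_i, bounds each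
   entry of D. *)
Lemma posdef_coercive (F : realType) m n (P : 'M[F]_m) : posdef P ->
  exists2 c, 0 < c & forall D : 'M[F]_(m, n),
    c * l1norm D ^+ 2 <= \tr (D^T *m P *m D).
Proof.
move=> Pd; have Pp := posdefW Pd; have [PT P0] := Pd.
have Pu := posdef_unitmx Pd.
pose y i : 'cV[F]_m := invmx P *m delta_mx i 0.
pose a := \sum_i ((y i)^T *m P *m y i) 0 0.
have a0 : 0 <= a by apply: sumr_ge0 => i _; apply Pp.
(* Each entry is at most sqrt (a t), so |D|^2 <= (m n)^2 a t; the added 1 keeps the constant
   invertible when m n or [a] vanishes. *)
exists (((m * n)%:R ^+ 2 * a + 1)^-1) => [|D].
  by rewrite invr_gt0 ltr_wpDl // mulr_ge0 // sqr_ge0.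
set t := \tr _; have t0 : 0 <= t by exact: mxtrace_congr_ge0.
have entry i j : `|D i j| <= Num.sqrt (a * t).
  rewrite -sqrtr_sqr ler_wsqrtr //.
  have -> : D i j = ((y i)^T *m P *m col j D) 0 0.
    rewrite /y trmx_mul -!mulmxA (mulmxA _ P) trmx_inv PT mulVmx // mul1mx.
    by rewrite trmx_delta -rowE !mxE.
  apply: le_trans (possemidef_CS _ _ Pp) _; apply: ler_pM; try apply Pp.
    by rewrite /a (bigD1 i) //= lerDl; apply: sumr_ge0 => k _; apply Pp.
  rewrite /t mxtrace_congr (bigD1 j) //= lerDl.
  by apply: sumr_ge0 => k _; apply Pp.
rewrite mulrC ler_pdivrMr; last by rewrite ltr_wpDl // mulr_ge0 // sqr_ge0.
have at0 : 0 <= a * t by exact: mulr_ge0.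
apply: (@le_trans _ _ (((m * n)%:R * Num.sqrt (a * t)) ^+ 2)).
  by rewrite lerXn2r ?nnegrE ?mulr_ge0 ?sqrtr_ge0 ?ler_l1norm_bound.
rewrite exprMn sqr_sqrtr // mulrDr mulr1 (_ : _ * (a * t) = t * ((m * n)%:R ^+ 2 * a)).
  by rewrite lerDl.
by ring.
Qed.

Lemma possemidef_mxtrace_ge0 (F : realType) n (P : 'M[F]_n) :
  possemidef P -> 0 <= \tr P.
Proof.
by move=> Pp; have := mxtrace_congr_ge0 1%:M Pp; rewrite tr_scalar_mx mul1mx mulmx1.
Qed.

(** By Cauchy-Schwarz the square of an entry is at most the product of two diagonal entries, each of
    which is at most the trace. *)
Lemma possemidef_l1norm_mxtrace (F : realType) n (P : 'M[F]_n) :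
  possemidef P -> l1norm P <= (n * n)%:R * \tr P.
Proof.
move=> Pp; apply: ler_l1norm_bound => i j.
have formE k l : ((delta_mx k 0 : 'cV[F]_n)^T *m P *m (delta_mx l 0 : 'cV[F]_n)) 0 0 = P k l.
  by rewrite trmx_delta -mulmxA -rowE mxE -colE mxE.
have diag k : 0 <= P k k <= \tr P.
  have P0 l : 0 <= P l l by rewrite -formE; apply Pp.
  by rewrite P0 /mxtrace (bigD1 k) //= lerDl; apply: sumr_ge0.
rewrite -(@ler_pXn2r _ 2) ?nnegrE //; last exact: possemidef_mxtrace_ge0.
have := possemidef_CS (delta_mx i 0) (delta_mx j 0) Pp; rewrite !formE.
rewrite real_normK ?num_real // => /le_trans -> //; rewrite expr2.
by case/andP: (diag i) => ? ?; case/andP: (diag j) => ? ?; apply: ler_pM.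
Qed.

Lemma ler_form_l1norm (F : realType) n (P : 'M[F]_n) (x : 'cV[F]_n) :
  `|(x^T *m P *m x) 0 0| <= l1norm P * l1norm x ^+ 2.
Proof.
apply: le_trans (ler_entry_l1norm _ _ _) _.
apply: le_trans (ler_l1normM _ _) _.
by rewrite expr2 mulrA ler_wpM2r // mulrC -(l1norm_tr x) ler_l1normM.
Qed.

Lemma formB (F : realType) n (P1 P2 : 'M[F]_n) (x : 'cV[F]_n) :
  (x^T *m (P1 - P2) *m x) 0 0 = (x^T *m P1 *m x) 0 0 - (x^T *m P2 *m x) 0 0.
Proof. by rewrite mulmxBr mulmxBl mxE [fun_of_matrix (- _) _ _]mxE. Qed.

(** * Lyapunov operators *)

(** The coercivity constant of P serves as radius: the form moves by at most |P' - P| |x|^2. *)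
Lemma posdef_open (F : realType) n (P : 'M[F]_n) : posdef P ->
  exists2 e, 0 < e &
    forall P' : 'M[F]_n, P'^T = P' -> l1norm (P' - P) < e -> posdef P'.
Proof.
move=> Pd; have [c c0 Pc] := posdef_coercive 1 Pd.
exists c => // P' P'T P'P; split=> // x x0.
have := Pc x; rewrite /mxtrace big_ord1 => Px.
have /le_lt_trans/(_ P'P) : 0 <= l1norm (P' - P) by [].
have xN0 : 0 < l1norm x.
  by rewrite ltNge; apply: contra x0 => /l1norm_le0 ->.
have := ler_form_l1norm (P' - P) x; rewrite formB.
rewrite ler_norml => /andP[+ _] _.
have : l1norm (P' - P) * l1norm x ^+ 2 < c * l1norm x ^+ 2.
  by rewrite ltr_pM2r // exprn_gt0.
lra.
Qed.

(** In vectorized coordinates f is a square matrix with trivial kernel, hence invertible; the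
    inverse gives both the bound and surjectivity. *)
Lemma linear_inj_bounded (F : realType) m n
    (f : {linear 'M[F]_(m, n) -> 'M[F]_(m, n)}) :
    (forall X, f X = 0 -> X = 0) ->
  (exists2 C, 0 < C & forall X, l1norm X <= C * l1norm (f X)) /\
  forall S, exists X, f X = S.
Proof.
move=> fI; pose L := lin_mx f.
have Lu : L \in unitmx.
  rewrite unitmxE unitfE; apply/negP => /det0P[v v0 vL].
  have : f (vec_mx v) = 0 by rewrite -mx_rV_lin vL linear0.
  by move=> /fI /(congr1 mxvec); rewrite vec_mxK linear0 => /eqP; apply/negP.
split; last first.
  move=> S; exists (vec_mx (mxvec S *m invmx L)).
  by rewrite -mx_rV_lin mulmxKV // mxvecK.
exists (l1norm (invmx L) + 1) => [|X]; first by rewrite ltr_wpDl.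
rewrite -(l1norm_mxvec X) -(l1norm_mxvec (f X)) -mul_vec_lin.
rewrite -{1}(mulmxK Lu (mxvec X)) mulrDl mul1r.
apply: le_trans (ler_l1normM _ _) _.
by rewrite mulrC lerDl.
Qed.

Definition lyap_op (F : realType) n (M X : 'M[F]_n) : 'M[F]_n :=
  M^T *m X + X *m M.

Fact lyap_op_is_linear (F : realType) n (M : 'M[F]_n) : linear (lyap_op M).
Proof.
move=> a X Y; rewrite /lyap_op mulmxDr mulmxDl -scalemxAr -scalemxAl scalerDr.
by rewrite addrACA.
Qed.

HB.instance Definition _ (F : realType) n (M : 'M[F]_n) :=
  GRing.isLinear.Build F 'M[F]_n 'M[F]_n *:%R (lyap_op M) (lyap_op_is_linear M).

Lemma trmx_lyap_op (F : realType) n (M X : 'M[F]_n) :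
  (lyap_op M X)^T = lyap_op M X^T.
Proof. by rewrite /lyap_op linearD /= !trmx_mul trmxK addrC. Qed.

Lemma ler_l1norm_lyap_op (F : realType) n (M X : 'M[F]_n) :
  l1norm (lyap_op M X) <= 2 * l1norm M * l1norm X.
Proof.
apply: le_trans (ler_l1normD _ _) _.
have := ler_l1normM M^T X; have := ler_l1normM X M; rewrite l1norm_tr.
lra.
Qed.

Lemma lyap_opB (F : realType) n (M M' X : 'M[F]_n) :
  lyap_op (M - M') X = lyap_op M X - lyap_op M' X.
Proof.
by rewrite /lyap_op linearB /= mulmxBl mulmxBr opprD addrACA.
Qed.

Definition lyap_inj (F : realType) n (M : 'M[F]_n) : Prop :=
  forall X, lyap_op M X = 0 -> X = 0.

Lemma lyap_op_inj (F : realType) n (M : 'M[F]_n) : lyap_inj M ->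
  injective (lyap_op M).
Proof.
by move=> MI X Y XY; apply/eqP; rewrite -subr_eq0; apply/eqP/MI; rewrite linearB /= XY subrr.
Qed.

Lemma lyap_sym (F : realType) n (M X : 'M[F]_n) : lyap_inj M ->
  (lyap_op M X)^T = lyap_op M X -> X^T = X.
Proof. by move=> MI; rewrite trmx_lyap_op => /(lyap_op_inj MI). Qed.

Lemma lyap_onto (F : realType) n (M S : 'M[F]_n) : lyap_inj M ->
  exists X, lyap_op M X = S.
Proof. by move=> MI; have [_] := @linear_inj_bounded _ _ _ (lyap_op M) MI; apply. Qed.

(** The inverse bound is uniform near M: replacing M by M' costs at most 2 |M' - M| |X|, which is
    absorbed into the left-hand side. *)
Lemma lyap_inj_open (F : realType) n (M : 'M[F]_n) : lyap_inj M ->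
  exists2 C, 0 < C & forall M', C * l1norm (M' - M) <= 1 ->
    forall X, l1norm X <= C * l1norm (lyap_op M' X).
Proof.
move=> MI; have [[C C0 CM] _] := @linear_inj_bounded _ _ _ (lyap_op M) MI.
(* The factor 4 makes the absorbed term at most |X| / 2. *)
exists (4 * C); first by rewrite mulr_gt0.
move=> M' M'M X; have /= := CM X.
have -> : lyap_op M X = lyap_op M' X - lyap_op (M' - M) X.
  by rewrite lyap_opB opprB addrC subrK.
have := ler_l1normB (lyap_op M' X) (lyap_op (M' - M) X).
have := ler_l1norm_lyap_op (M' - M) X.
have : 0 <= l1norm X by [].
have : 0 <= l1norm (lyap_op M' X) by [].
move: M'M.
set a := l1norm (M' - M); set x := l1norm X; set y := l1norm _.
set u := l1norm (lyap_op (M' - M) X); set v := l1norm _.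
move=> h1 y0 x0 h2 h3 h4.
have h5 : C * v <= C * (y + 2 * a * x) by rewrite ler_pM2l //; lra.
have : 4 * C * a * x <= 1 * x by rewrite ler_wpM2r.
lra.
Qed.

(** Continuous dependence on data and operator: L_{M'} (X' - X) is the difference of the two
    right-hand sides minus L_{M' - M} X. *)
Lemma lyap_perturb (F : realType) n (M M' X X' : 'M[F]_n) C :
  (forall Z, l1norm Z <= C * l1norm (lyap_op M' Z)) -> 0 < C ->
  l1norm (X' - X) <= C * (l1norm (lyap_op M' X' - lyap_op M X) +
                          2 * l1norm (M' - M) * l1norm X).
Proof.
move=> CM' C0; apply: le_trans (CM' _) _; rewrite ler_pM2l //.
have -> : lyap_op M' (X' - X) =
    (lyap_op M' X' - lyap_op M X) - lyap_op (M' - M) X.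
  by rewrite linearB lyap_opB /= opprB addrA subrK.
apply: le_trans (ler_l1normB _ _) _.
by rewrite lerD2l ler_l1norm_lyap_op.
Qed.

(** * Hurwitz matrices and kernels of Lyapunov operators *)

Lemma eigenvalue_unitmx (K : fieldType) n (M : 'M[K]_n) z :
  eigenvalue M z = (M - z%:M \notin unitmx).
Proof. by rewrite -row_free_unit -kermx_eq0. Qed.

Lemma eigenvalue_trmx (K : fieldType) n (M : 'M[K]_n) z :
  eigenvalue M^T z = eigenvalue M z.
Proof.
by rewrite !eigenvalue_unitmx -(unitmx_tr (M - _)) linearB /= tr_scalar_mx.
Qed.

Lemma hurwitz_trmx (F : realType) n (M : 'M[F]_n) : hurwitz M -> hurwitz M^T.
Proof. by move=> hM z; rewrite -map_trmx eigenvalue_trmx => /hM. Qed.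

(* M^T X + X M = t X gives X q(M) = q(t - M^T) X for every polynomial q.  For q
   the characteristic polynomial of M the left side is 0 and q(t - M^T) is
   invertible, since t - z has positive real part for every eigenvalue z. *)
Lemma hurwitz_lyap_inj (F : realType) n (M X : 'M[F]_n) t :
  hurwitz M -> 0 <= t -> lyap_op M X = t *: X -> X = 0.
Proof.
case: n M X => [|n] M X hM t0 MX; first by apply/matrixP => -[].
pose c := real_complex F.
have [rs char_rs] := closed_field_poly_normal (char_poly (map_mx c M)).
rewrite (monicP (char_poly_monic _)) scale1r in char_rs.
have rs_lt0 z : z \in rs -> complex.Re z < 0.
  by move=> zrs; apply: hM; rewrite eigenvalue_root_char char_rs root_prod_XsubC.
have MXc : map_mx c X *m map_mx c M = (c t)%:M *m map_mx c X - (map_mx c M)^T *m map_mx c X.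
  rewrite mul_scalar_mx -map_mxZ -MX map_mxD map_trmx -!map_mxM.
  by rewrite addrAC subrr add0r.
have intertwine (s : seq F[i]) : map_mx c X *m \prod_(z <- s) (map_mx c M - z%:M) =
    (\prod_(z <- s) ((c t)%:M - (map_mx c M)^T - z%:M)) *m map_mx c X.
  elim: s => [|z s IH]; first by rewrite !big_nil mulmx1 mul1mx.
  rewrite !big_cons -!mulmxE mulmxA mulmxBr MXc -mulmxBl (scalar_mxC z) -mulmxBl.
  by rewrite -!mulmxA IH.
have := Cayley_Hamilton (map_mx c M); rewrite char_rs rmorph_prod /= => CH.
have {}CH : \prod_(z <- rs) (map_mx c M - z%:M) = 0.
  rewrite -[RHS]CH; apply: eq_bigr => z _.
  by rewrite rmorphB /= horner_mx_X horner_mx_C.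
have := intertwine rs; rewrite CH mulmx0 => /esym X0.
suff X00 : map_mx c X = 0.
  by apply/eqP; rewrite -(map_mx_eq0 (real_complex F)); apply/eqP.
have U : \prod_(z <- rs) ((c t)%:M - (map_mx c M)^T - z%:M) \in unitmx.
  rewrite big_seq; apply: (big_ind (fun Z => Z \in unitmx)) => [|x y xu yu|z zrs]; first exact: unitmx1.
    by rewrite unitmx_mul xu.
  rewrite -unitmx_tr !linearB /= trmxK !tr_scalar_mx addrAC -opprB -raddfB /=.
  rewrite -scaleN1r unitmxZ ?unitrN1 //; apply: contraT; rewrite -eigenvalue_unitmx => /hM.
  rewrite raddfB /= ltNge.
  by rewrite subr_ge0 (le_trans (ltW (rs_lt0 _ zrs))).
by rewrite -(mulKmx U (map_mx c X)) X0 mulmx0.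
Qed.

(** * Positivity of Lyapunov solutions *)

(* A homotopy of injective Lyapunov operators from lyap_op M to - id. *)
Definition lyap_path (F : realType) n (M : 'M[F]_n) (s : F) : 'M[F]_n :=
  (1 - s) *: M - (s / 2)%:M.

Lemma lyap_op_path (F : realType) n (M X : 'M[F]_n) s :
  lyap_op (lyap_path M s) X = (1 - s) *: lyap_op M X - s *: X.
Proof.
rewrite /lyap_path lyap_opB /lyap_op tr_scalar_mx scalar_mxC mul_scalar_mx.
by rewrite -scalerDl -splitr linearZ /= -scalemxAl -scalemxAr scalerDr.
Qed.

(** For s < 1 a kernel element satisfies L_M X = (s / (1 - s)) X with a nonnegative factor, which
    [hurwitz_lyap_inj] excludes unless X = 0; at s = 1 the operator is - id. *)
Lemma lyap_path_inj (F : realType) n (M : 'M[F]_n) s :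
  hurwitz M -> 0 <= s <= 1 -> lyap_inj (lyap_path M s).
Proof.
move=> hM /andP[s0 s1] X /eqP; rewrite lyap_op_path subr_eq0 => /eqP MX.
have [s1E|sN1] := eqVneq s 1.
  by move: MX; rewrite s1E subrr scale0r scale1r.
have s1' : 0 < 1 - s by rewrite subr_gt0 lt_neqAle sN1.
apply: (@hurwitz_lyap_inj _ _ M _ (s / (1 - s)) hM).
  by rewrite divr_ge0 // ltW.
by rewrite mulrC -scalerA -MX scalerA mulVf ?scale1r // gt_eqF.
Qed.

Lemma lyap_path_cont (F : realType) n (M S X : 'M[F]_n) s e :
  hurwitz M -> 0 <= s <= 1 -> lyap_op (lyap_path M s) X = S -> 0 < e ->
  exists2 d, 0 < d & forall s' X', `|s' - s| < d ->
    lyap_op (lyap_path M s') X' = S -> l1norm (X' - X) < e.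
Proof.
move=> hM s01 MX e0.
have [C C0 MC] := lyap_inj_open (lyap_path_inj hM s01).
pose k := l1norm (M + (2^-1)%:M).
have k0 : 0 <= k by exact: l1norm_ge0.
have kx : 0 <= k * l1norm X by apply: mulr_ge0.
(* The inverse of the radius, [k] being the speed of the path. The first term keeps M_{s'} where the
   inverse bound [C] holds, the last makes the error smaller than [e], and 1 ensures positivity. *)
pose q := C * k + 1 + 2 * C * (k * l1norm X) / e.
have q0 : 0 < q.
  have : 0 <= C * k by rewrite mulr_ge0 // ltW.
  have : 0 <= 2 * C * (k * l1norm X) / e by rewrite !mulr_ge0 ?invr_ge0 // ltW.
  rewrite /q; lra.
exists q^-1 => [|s' X' s's MX']; first by rewrite invr_gt0.
have dist : l1norm (lyap_path M s' - lyap_path M s) = `|s' - s| * k.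
  rewrite -normrN -l1normZ; congr l1norm; rewrite /lyap_path scalerDr.
  rewrite scale_scalar_mx opprD addrACA; congr (_ + _).
    by rewrite -scalerBl; congr (_ *: _); ring.
  apply/matrixP => i j; rewrite !mxE.
  by case: eqP => _; rewrite ?mulr1n ?mulr0n; field.
have {s's}qs : `|s' - s| * q < 1 by rewrite -ltr_pdivlMr ?div1r.
have a0 : 0 <= `|s' - s| by [].
move: dist qs a0; set a := `|s' - s| => dist qs a0.
have aCk0 : 0 <= a * (C * k) by rewrite !mulr_ge0 // ltW.
have aCkx : 0 <= a * (2 * C * (k * l1norm X) / e).
  by rewrite !mulr_ge0 ?invr_ge0 // ltW.
have qsE : a * q = a * (C * k) + a + a * (2 * C * (k * l1norm X) / e).
  by rewrite /q; ring.
have H1 : C * l1norm (lyap_path M s' - lyap_path M s) <= 1.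
  by rewrite dist; lra.
apply: le_lt_trans (lyap_perturb (lyap_path M s) X X' (MC _ H1) C0) _.
rewrite MX MX' subrr l1norm0 add0r dist.
have : a * (2 * C * (k * l1norm X) / e) < 1 by lra.
rewrite (_ : a * _ = C * (2 * (a * k) * l1norm X) / e); last by ring.
by rewrite ltr_pdivrMr // mul1r.
Qed.

(* Along the homotopy, the solution at s = 1 is S itself.  A solution which is
   positive semidefinite cannot have a kernel, because S is definite, so positive
   definiteness is both open and closed in s and persists down to s = 0. *)
Lemma lyap_posdef (F : realType) n (M X S : 'M[F]_n) :
  hurwitz M -> posdef S -> lyap_op M X = - S -> posdef X.
Proof.
move=> hM Sd MX; have [ST _] := Sd.
pose E : set F := [set s | 0 <= s <= 1 /\
  exists Z, lyap_op (lyap_path M s) Z = - S /\ posdef Z]%classic.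
have E1 : E 1.
  split; first by rewrite ler01 lexx.
  exists S; split=> //.
  by rewrite lyap_op_path subrr scale0r scale1r add0r.
have Eb : has_inf E by split; [exists 1|exists 0 => s [/andP[]]].
have E0 s : E s -> inf E <= s by move=> Es; apply: ge_inf => //; exact: Eb.2.
have s01 : 0 <= inf E <= 1.
  rewrite E0 // andbT; apply: lb_le_inf; first exact: Eb.1.
  by move=> s [/andP[]].
(* [Z] solves the equation at the infimum. Definite solutions exist arbitrarily close to it, so a
   negative value of its form would persist in one of them. *)
have [Z MZ] := lyap_onto (- S) (lyap_path_inj hM s01).
have ZT : Z^T = Z.
  by apply: lyap_sym (lyap_path_inj hM s01) _; rewrite MZ linearN /= ST.
have Zp : possemidef Z.
  split=> // x; rewrite leNgt; apply/negP => Zx.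
  pose e := - (x^T *m Z *m x) 0 0.
  have x0 : 0 < l1norm x ^+ 2 + 1 by rewrite ltr_wpDl ?sqr_ge0.
  have [|d d0 dZ] := lyap_path_cont hM s01 MZ (_ : 0 < e / (l1norm x ^+ 2 + 1)).
    by rewrite divr_gt0 // /e oppr_gt0.
  have [s [ss [Z' [MZ' Z'd]]] sE] := inf_adherent d0 Eb.
  have /dZ/(_ MZ') : `|s - inf E| < d.
    by rewrite ger0_norm ?subr_ge0 ?E0 // ?ltrBlDl //; split=> //; exists Z'.
  rewrite ltr_pdivlMr //.
  have := (posdefW Z'd).2 x.
  have := ler_form_l1norm (Z' - Z) x; rewrite formB.
  rewrite ler_norml => /andP[_ +].
  have : 0 <= l1norm (Z' - Z) by [].
  rewrite /e; lra.
have Zd : posdef Z.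
  split=> // x x0; rewrite lt_neqAle Zp.2 andbT eq_sym; apply/eqP.
  move=> /(possemidef_ker Zp) Zx.
  have xZ : x^T *m Z = 0 by rewrite -[Z]trmxK -trmx_mul ZT Zx trmx0.
  have := Sd.2 x x0; rewrite -[S]opprK -MZ mulmxN mulNmx.
  rewrite /lyap_op mulmxDr mulmxDl !mulmxA xZ !mul0mx addr0.
  by rewrite -!mulmxA Zx !mulmx0 oppr0 mxE ltxx.
have [E00|EN0] := eqVneq (inf E) 0.
  move: MZ; rewrite E00 lyap_op_path subr0 scale1r scale0r subr0 -MX => ZX.
  have <- // : Z = X.
  apply: (lyap_op_inj (M := M)) ZX => Y MY.
  by apply: (hurwitz_lyap_inj hM (lexx 0)); rewrite MY scale0r.
exfalso; have Epos : 0 < inf E by rewrite lt0r EN0; case/andP: s01.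
have [e e0 eZ] := posdef_open Zd.
have [d d0 dZ] := lyap_path_cont hM s01 MZ e0.
(* A parameter strictly below the infimum, within [d] of it and still in [0, 1]. Its solution is
   definite by openness, contradicting minimality. *)
pose s := Num.max 0 (inf E - d / 2).
have sE : s < inf E.
  by rewrite gt_max Epos ltrBlDr ltrDl divr_gt0.
have ss : 0 <= s <= 1.
  rewrite le_max lexx /= (le_trans (ltW sE)) //; by case/andP: s01.
have [Z' MZ'] := lyap_onto (- S) (lyap_path_inj hM ss).
have sd : `|s - inf E| < d.
  rewrite ltr0_norm ?subr_lt0 // opprB ltrBlDr -ltrBlDl lt_max; apply/orP; right.
  lra.
have := sE; rewrite ltNge => /negP; apply; apply: E0; split=> //.
exists Z'; split=> //; apply: eZ; last exact: dZ sd MZ'.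
by apply: lyap_sym (lyap_path_inj hM ss) _; rewrite MZ' linearN /= ST.
Qed.

Lemma hurwitz_inj (F : realType) n (M : 'M[F]_n) : hurwitz M -> lyap_inj M.
Proof.
by move=> hM X MX; apply: (hurwitz_lyap_inj hM (lexx 0)); rewrite scale0r.
Qed.

(** Approximation by the definite case: if Z solves the equation with right-hand side - 1, then X +
    e Z solves it with - (S + e 1), so it is definite for every e > 0. *)
Lemma lyap_possemidef (F : realType) n (M X S : 'M[F]_n) :
  hurwitz M -> possemidef S -> lyap_op M X = - S -> possemidef X.
Proof.
move=> hM Sp MX; have MI := hurwitz_inj hM.
have XT : X^T = X by apply: lyap_sym MI _; rewrite MX linearN /= Sp.1.
have [Z MZ] := lyap_onto (- 1%:M) MI.
have Zd := lyap_posdef hM (posdef1 _ _) MZ.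
split=> // x; rewrite leNgt; apply/negP => Xx.
pose q := (x^T *m Z *m x) 0 0; have q0 : 0 <= q by exact: (posdefW Zd).2.
(* With this [e] the form of X + e Z at [x] equals - e. *)
pose e := - (x^T *m X *m x) 0 0 / (q + 1).
have e0 : 0 < e by rewrite divr_gt0 ?oppr_gt0 // ltr_wpDl.
have : posdef (X + e *: Z).
  apply: (lyap_posdef hM (posdefD Sp (posdefZ e0 (posdef1 _ _)))).
  by rewrite linearD linearZ /= MX MZ scalerN opprD.
move=> /posdefW [_ /(_ x)]; rewrite mulmxDr mulmxDl -scalemxAr -scalemxAl.
rewrite [fun_of_matrix (_ + _) _ _]mxE [fun_of_matrix (_ *: _) _ _]mxE -/q.
have : e * (q + 1) = - (x^T *m X *m x) 0 0 by rewrite divfK // gt_eqF // ltr_wpDl.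
lra.
Qed.

(** * Observability and the Lyapunov equation of a gain *)

(** The rank condition in the form used below: every C A^i vanishes on an A-invariant family
    contained in the kernel of C, and the stacked matrix is injective. A predicate [V] suffices to
    describe the family. *)
Lemma observable_invariant (F : realType) n p (A : 'M[F]_n) (C : 'M[F]_(p, n))
    (V : 'cV[F]_n -> Prop) : observable A C ->
  (forall x, V x -> V (A *m x) /\ C *m x = 0) -> forall x, V x -> x = 0.
Proof.
move=> AC VA x Vx.
have CAx i : C *m A ^+ i *m x = 0.
  have : V (A ^+ i *m x).
    elim: i => [|i IH]; first by rewrite expr0 mul1mx.
    by rewrite exprS -mulmxE -mulmxA; apply VA.
  by move=> /VA[_]; rewrite mulmxA.
have AC' : row_full (\mxcol_(i < n) (C *m A ^+ i)) by apply/eqP.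
apply: (row_full_inj AC'); rewrite mulmx0 mxcol_mul.
by under eq_mxcol do rewrite CAx; rewrite mxcol0.
Qed.

Lemma posdef_form_eq0 (F : realType) n (P : 'M[F]_n) (x : 'cV[F]_n) :
  posdef P -> (x^T *m P *m x) 0 0 = 0 -> x = 0.
Proof.
move=> [_ P0] Px; apply/eqP; apply/negPn/negP => /P0.
by rewrite Px ltxx.
Qed.

(** The weight of the running cost under the feedback u = - K x. *)
Definition stage_cost (F : realType) n m (Q : 'M[F]_n) (R : 'M[F]_m)
  (K : 'M[F]_(m, n)) : 'M[F]_n := Q + K^T *m R *m K.

Lemma lyap_solutionE (F : realType) n m (A : 'M[F]_n) (B : 'M[F]_(n, m))
    (Q : 'M[F]_n) (R : 'M[F]_m) K P :
  lyap_solution A B Q R K P <->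
  posdef P /\ lyap_op (A - B *m K) P = - stage_cost Q R K.
Proof.
rewrite /lyap_solution /lyap_op /stage_cost -[_ + Q + _]addrA.
by split=> -[Pd /eqP PE]; split=> //; apply/eqP; rewrite ?addr_eq0 // -addr_eq0.
Qed.

Lemma possemidef_stage_cost (F : realType) n m (Q : 'M[F]_n) (R : 'M[F]_m)
    (K : 'M[F]_(m, n)) :
  possemidef Q -> posdef R -> possemidef (stage_cost Q R K).
Proof.
by move=> Qp Rd; apply: possemidefD => //; apply/possemidef_congr/posdefW.
Qed.

(** The form is the sum of |C x|^2 and the [R]-form of K x, both nonnegative and both definite in
    their arguments. *)
Lemma stage_cost_form_eq0 (F : realType) n m (Q C : 'M[F]_n) (R : 'M[F]_m)
    (K : 'M[F]_(m, n)) (x : 'cV[F]_n) :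
  possemidef C -> C *m C = Q -> posdef R ->
  (x^T *m stage_cost Q R K *m x) 0 0 = 0 -> C *m x = 0 /\ K *m x = 0.
Proof.
move=> [CT _] CQ Rd.
have QE : x^T *m Q *m x = (C *m x)^T *m 1%:M *m (C *m x).
  by rewrite -CQ trmx_mul CT mulmx1 !mulmxA.
have RE : x^T *m (K^T *m R *m K) *m x = (K *m x)^T *m R *m (K *m x).
  by rewrite trmx_mul !mulmxA.
rewrite /stage_cost mulmxDr mulmxDl QE RE [fun_of_matrix (_ + _) _ _]mxE.
move=> /eqP; rewrite paddr_eq0.
- move=> /andP[/eqP Q0 /eqP R0]; split; last exact: posdef_form_eq0 R0.
  by apply: posdef_form_eq0 Q0; apply: posdef1.
- exact: (posdefW (posdef1 F n)).2.
- exact: (posdefW Rd).2.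
Qed.

(** Makes the kernel of P invariant under M: testing the equation at x kills the form of W, hence W
    x, and what remains of the equation applied to x is P M x = 0. *)
Lemma lyap_op_ker (F : realType) n (M P W : 'M[F]_n) (x : 'cV[F]_n) :
  P^T = P -> possemidef W -> lyap_op M P = - W -> P *m x = 0 ->
  (x^T *m W *m x) 0 0 = 0 /\ P *m (M *m x) = 0.
Proof.
move=> PT Wp MP Px.
have xP : x^T *m P = 0 by rewrite -[P]trmxK -trmx_mul PT Px trmx0.
have xW : (x^T *m W *m x) 0 0 = 0.
  rewrite -[W]opprK -MP mulmxN mulNmx /lyap_op mulmxDr mulmxDl !mulmxA xP.
  by rewrite !mul0mx addr0 -!mulmxA Px !mulmx0 oppr0 mxE.
split=> //; have := possemidef_ker Wp xW.
rewrite -[W]opprK -MP mulNmx /lyap_op mulmxDl -!mulmxA Px mulmx0 add0r.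
by move=> /eqP; rewrite oppr_eq0 => /eqP.
Qed.

(** The solution is semidefinite, and its kernel is invariant under A - B K and killed by C and K.
    On it A and A - B K agree, so observability reduces it to zero. *)
Lemma lyap_solution_exists (F : realType) n m (A : 'M[F]_n) (B : 'M[F]_(n, m))
    (Q C : 'M[F]_n) (R : 'M[F]_m) K :
  possemidef Q -> posdef R -> possemidef C -> C *m C = Q -> observable A C ->
  stabilizing A B K -> exists P, lyap_solution A B Q R K P.
Proof.
move=> Qp Rd Cp CQ AC hK.
have [P MP] := lyap_onto (- stage_cost Q R K) (hurwitz_inj hK).
have Wp := possemidef_stage_cost K Qp Rd.
have Pp := lyap_possemidef hK Wp MP.
exists P; apply/lyap_solutionE; split=> //; split=> [|x x0]; first exact: Pp.1.
rewrite lt_neqAle Pp.2 andbT eq_sym; apply: contra x0.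
move=> /eqP /(possemidef_ker Pp) Px; apply/eqP.
apply: (observable_invariant (V := fun x => P *m x = 0) AC) Px => {}x Px.
have [Wx PMx] := lyap_op_ker Pp.1 Wp MP Px.
have [Cx Kx] := stage_cost_form_eq0 Cp CQ Rd Wx; split=> //.
by rewrite -PMx mulmxBl -[B *m K *m x]mulmxA Kx mulmx0 subr0.
Qed.

(* x + i y is a complex eigenvector of M. *)
Lemma complex_eigenvectorP (F : realType) n (M : 'M[F]_n) z :
  eigenvalue (map_mx (real_complex F) M) z -> exists x y : 'cV[F]_n,
  [/\ (x != 0) || (y != 0),
      M *m x = complex.Re z *: x - complex.Im z *: y &
      M *m y = complex.Im z *: x + complex.Re z *: y].
Proof.
(* [eigenvalue] refers to row vectors; the transpose provides a column eigenvector. *)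
set c := real_complex F; rewrite -eigenvalue_trmx => /eigenvalueP[v vM v0].
pose x := map_mx (@complex.Re F) v^T; pose y := map_mx (@complex.Im F) v^T.
have ReD (s t : F[i]) : complex.Re (s + t) = complex.Re s + complex.Re t.
  by case: s t => [? ?] [? ?].
have ImD (s t : F[i]) : complex.Im (s + t) = complex.Im s + complex.Im t.
  by case: s t => [? ?] [? ?].
have vE i : \sum_j c (M i j) * v 0 j = z * v 0 i.
  have := congr1 (fun A : 'rV_n => A 0 i) vM; rewrite !mxE => <-.
  by apply: eq_bigr => j _; rewrite !mxE mulrC.
exists x, y; split.
- apply: contraR v0; rewrite negb_or !negbK => /andP[/eqP x0 /eqP y0].
  apply/eqP/matrixP => i j; rewrite ord1 mxE; apply/eqP; rewrite eq_complex /=.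
  have := congr1 (fun A : 'cV_n => A j 0) x0; rewrite !mxE => ->.
  by have := congr1 (fun A : 'cV_n => A j 0) y0; rewrite !mxE => ->; rewrite !eqxx.
- apply/matrixP => i j; rewrite !mxE.
  have := congr1 (@complex.Re F) (vE i).
  rewrite (big_morph _ ReD (erefl : complex.Re (0 : F[i]) = 0)).
  rewrite (_ : complex.Re (z * _) = complex.Re z * complex.Re (v 0 i) -
      complex.Im z * complex.Im (v 0 i)); last first.
    by case: (z) (v 0 i) => [? ?] [? ?].
  rewrite ord1 => <-; apply: eq_bigr => k _; rewrite !mxE.
  by case: (v 0 k) => [? ?] /=; rewrite mul0r subr0.
- apply/matrixP => i j; rewrite !mxE.
  have := congr1 (@complex.Im F) (vE i).
  rewrite (big_morph _ ImD (erefl : complex.Im (0 : F[i]) = 0)).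
  rewrite (_ : complex.Im (z * _) = complex.Im z * complex.Re (v 0 i) +
      complex.Re z * complex.Im (v 0 i)); last first.
    by case: (z) (v 0 i) => [? ?] [? ?]; rewrite addrC.
  rewrite ord1 => <-; apply: eq_bigr => k _; rewrite !mxE.
  by case: (v 0 k) => [? ?] /=; rewrite mul0r addr0.
Qed.

(** P acts as a Lyapunov function on the real and imaginary parts x, y of an eigenvector: W(x) +
    W(y) = - 2 Re z (P(x) + P(y)), so Re z <= 0. Equality would give a nonzero A-invariant space in
    the kernel of C. This yields the stability of the optimal gain. *)
Lemma lyap_solution_stabilizing (F : realType) n m (A : 'M[F]_n) (B : 'M[F]_(n, m))
    (Q C : 'M[F]_n) (R : 'M[F]_m) K P :
  possemidef Q -> posdef R -> possemidef C -> C *m C = Q -> observable A C ->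
  lyap_solution A B Q R K P -> stabilizing A B K.
Proof.
move=> Qp Rd Cp CQ AC /lyap_solutionE[Pd MP] z /complex_eigenvectorP[x [y]].
set a := complex.Re z; set b := complex.Im z; set M := A - B *m K => -[xy0 Mx My].
have Wp := possemidef_stage_cost K Qp Rd.
move: MP Wp; rewrite -/M; set W := stage_cost Q R K => MP Wp.
have PT := Pd.1.
pose f (u v : 'cV[F]_n) : F := (u^T *m P *m v) 0 0.
have fW u : (u^T *m W *m u) 0 0 = - 2 * f u (M *m u).
  rewrite -[W]opprK -MP mulmxN mulNmx /lyap_op mulmxDr mulmxDl.
  rewrite [fun_of_matrix (- _) _ _]mxE [fun_of_matrix (_ + _) _ _]mxE.
  rewrite mulNr mulr_natl mulr2n /f !mulmxA; congr (- (_ + _)).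
  by rewrite -[u^T *m M^T]trmx_mul bilinear_tr // mulmxA.
have fD u v w s t : f u (s *: v + t *: w) = s * f u v + t * f u w.
  rewrite /f mulmxDr -!scalemxAr [fun_of_matrix (_ + _) _ _]mxE.
  by rewrite ![fun_of_matrix (_ *: _) _ _]mxE.
have fC : f y x = f x y by rewrite /f bilinear_tr.
have WE : (x^T *m W *m x) 0 0 + (y^T *m W *m y) 0 0 = - 2 * (a * (f x x + f y y)).
  rewrite !fW Mx My -scaleNr !fD fC; ring.
have Wx0 := Wp.2 x; have Wy0 := Wp.2 y.
have p0 : 0 < f x x + f y y.
  by case/orP: xy0 => u0; [apply: ltr_pwDl|apply: ltr_wpDl];
    rewrite ?(posdefW Pd).2 ?Pd.2 //; apply: (posdefW Pd).2.
rewrite lt_neqAle; apply/andP; split; last first.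
  rewrite leNgt; apply/negP => a0.
  have := mulr_gt0 a0 p0; lra.
apply/negP => /eqP a0; move: WE; rewrite a0 mul0r mulr0 => /eqP.
rewrite paddr_eq0 // => /andP[/eqP Wx /eqP Wy].
have [Cx Kx] := stage_cost_form_eq0 Cp CQ Rd Wx.
have [Cy Ky] := stage_cost_form_eq0 Cp CQ Rd Wy.
have AM u : K *m u = 0 -> A *m u = M *m u.
  by move=> Ku; rewrite mulmxBl -[B *m K *m u]mulmxA Ku mulmx0 subr0.
(* K vanishes on the span of x and y, so A agrees with M there; as a = 0, M sends x to - b y and y
   to b x, which leaves the span invariant. *)
have V0 : forall u, (exists s t, u = s *: x + t *: y) -> u = 0.
  apply: (observable_invariant AC) => u [s [t ->]]; split; last first.
    by rewrite mulmxDr -!scalemxAr Cx Cy !scaler0 addr0.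
  exists (t * b), (- s * b).
  rewrite AM; last by rewrite mulmxDr -!scalemxAr Kx Ky !scaler0 addr0.
  rewrite mulmxDr -!scalemxAr Mx My a0 !scale0r sub0r addr0 scalerN !scalerA.
  by rewrite mulNr scaleNr addrC.
move: xy0; rewrite (V0 x); last by exists 1, 0; rewrite scale1r scale0r addr0.
rewrite (V0 y) ?eqxx //; by exists 0, 1; rewrite scale1r scale0r add0r.
Qed.

Lemma lyap_P_eq (F : realType) n m (A : 'M[F]_n) (B : 'M[F]_(n, m))
    (Q : 'M[F]_n) (R : 'M[F]_m) K P :
  lyap_inj (A - B *m K) -> lyap_solution A B Q R K P -> lyap_P A B Q R K = P.
Proof.
move=> MI PS; apply: xget_unique => // P' /lyap_solutionE[_ MP'].
by move/lyap_solutionE: PS => [_ MP]; apply: (lyap_op_inj MI); rewrite MP'.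
Qed.

(** * Gradient of the cost *)

Fact frob_inner_is_linear (F : realType) m n (G : 'M[F]_(m, n)) :
  linear (frob_inner G : 'M[F]_(m, n) -> F^o).
Proof. by move=> a X Y; rewrite /frob_inner linearP /= linearP. Qed.

HB.instance Definition _ (F : realType) m n (G : 'M[F]_(m, n)) :=
  GRing.isLinear.Build F 'M[F]_(m, n) F^o *:%R (frob_inner G)
    (frob_inner_is_linear G).

Lemma ler_frob_inner (F : realType) m n (G H : 'M[F]_(m, n)) :
  `|frob_inner G H| <= l1norm G * l1norm H.
Proof.
apply: le_trans (ler_mxtrace_l1norm _) _; rewrite -(l1norm_tr G).
exact: ler_l1normM.
Qed.

Lemma frob_inner_inj (F : realType) m n : injective (@frob_inner F m n).
Proof.
move=> G1 G2 G12; apply/matrixP => i j.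
have E G : frob_inner G (delta_mx i j) = G i j.
  rewrite /frob_inner mxtrace_mulC -[delta_mx i j]mul1mx.
  rewrite /mxtrace (bigD1 i) //= big1 => [|k ki].
    rewrite mul1mx mxE (bigD1 j) //= big1 => [|l lj].
      by rewrite !mxE !eqxx mul1r !addr0.
    by rewrite !mxE (negPf lj) andbF mul0r.
  by rewrite mul1mx mxE big1 // => l _; rewrite !mxE (negPf ki) mul0r.
by rewrite -!E G12.
Qed.

Lemma ler_l1norm_norm (F : realType) m n (M : 'M[F]_(m, n)) :
  l1norm M <= (m * n)%:R * `|M|.
Proof.
apply: ler_l1norm_bound => i j; rewrite [leRHS]/Num.Def.normr /= mx_normrE.
by apply/bigmax_geP; right => /=; exists (i, j).
Qed.

(** A remainder quadratic in [l1norm] is negligible against the sup norm, since the former is at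
    most [N] times the latter. *)
Lemma is_gradient_quad (F : realType) m n (f : 'M[F]_(m, n) -> F)
    (K G : 'M[F]_(m, n)) c d :
  0 < d -> (forall H, l1norm H < d ->
    `|f (K + H) - f K - frob_inner G H| <= c * l1norm H ^+ 2) ->
  is_gradient f K G.
Proof.
move=> d0 fK; pose N : F := (m * n)%:R + 1.
have N0 : 0 < N by rewrite ltr_wpDl.
have lN (M : 'M[F]_(m, n)) : l1norm M <= N * `|M|.
  by apply: le_trans (ler_l1norm_norm M) _; rewrite ler_wpM2r // lerDl.
have Gc : continuous (frob_inner G : 'M[F]_(m, n) -> F^o).
  apply: bounded_linear_continuous; apply/linear_boundedP.
  near=> r => x; apply: le_trans (ler_frob_inner G x) _.
  apply: (@le_trans _ _ (l1norm G * N * `|x|)).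
    by rewrite -mulrA ler_wpM2l.
  by rewrite ler_wpM2r //; near: r; apply: nbhs_pinfty_ge; rewrite num_real.
have Gd : (f : _ -> F^o) \o shift K =
    cst (f K : F^o) + (frob_inner G : _ -> F^o) +o_ (0 : 'M[F]_(m, n)) id.
  apply/eqaddoP => _/posnumP[e].
  (* The first bound gives |H| < d in [l1norm]; the second makes |c| (N |H|)^2 at most e |H|. *)
  pose r := Num.min (d / N) (e%:num / (N ^+ 2 * (`|c| + 1))).
  have Nc0 : 0 < N ^+ 2 * (`|c| + 1) by rewrite mulr_gt0 ?exprn_gt0 // ltr_wpDl.
  have r0 : 0 < r by rewrite lt_min !divr_gt0.
  have small : \forall H \near (0 : 'M[F]_(m, n)), `|H| < r by exact: nbhs0_lt.
  near=> H.
  have : `|H| < r by near: H; exact: small.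
  rewrite lt_min !ltr_pdivlMr // => /andP[Hd He].
  have HN : l1norm H <= N * `|H| := lN H.
  rewrite /= opprD addrA !fctE /= [H + K]addrC.
  have /fK H1 : l1norm H < d by rewrite (le_lt_trans HN) // mulrC.
  apply: le_trans H1 _.
  apply: (@le_trans _ _ (`|c| * (N * `|H|) ^+ 2)).
    apply: (@le_trans _ _ (`|c| * l1norm H ^+ 2)).
      by rewrite ler_wpM2r ?sqr_ge0 // ler_norm.
    by rewrite ler_wpM2l // lerXn2r ?nnegrE // mulr_ge0 // ltW.
  rewrite (_ : _ * _ = `|H| * (N ^+ 2 * `|c|) * `|H|); last by ring.
  rewrite ler_wpM2r // (le_trans _ (ltW He)) // ler_wpM2l //.
  by rewrite ler_wpM2l ?lerDl // exprn_ge0 // ltW.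
have Gdiff : 'd (f : _ -> F^o) K = frob_inner G :> (_ -> F^o) by exact: diff_unique.
split; last by move=> H; rewrite -[RHS]/((frob_inner G : _ -> F^o) H) -Gdiff.
apply/diff_locallyP; rewrite Gdiff; split=> //.
Unshelve. all: by end_near. Qed.

Lemma gradient_eq (F : realType) m n (f : 'M[F]_(m, n) -> F) K G :
  is_gradient f K G -> gradient f K = G.
Proof.
move=> fG; apply: xget_unique => // G' fG'; apply: frob_inner_inj.
by apply/funext => H; rewrite -fG.2 -fG'.2.
Qed.

(** L_M and L_{M^T} are adjoint for the trace pairing, and Y is the preimage of - 1 under the
    latter. *)
Lemma mxtrace_lyap (F : realType) n (M X W Y : 'M[F]_n) :
  lyap_op M X = - W -> lyap_op M^T Y = - 1%:M -> \tr X = \tr (W *m Y).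
Proof.
move=> MX MY; rewrite -[W]opprK -MX -[X in LHS]mulmx1 -[1%:M]opprK -MY.
rewrite /lyap_op trmxK mulmxN mulNmx !linearN /= mulmxDl mulmxDr !linearD /=.
rewrite addrC !mulmxA; congr (- _ - _).
by rewrite mxtrace_mulC mulmxA.
Qed.


(** Subtracting the Lyapunov equations at K and K + H and pairing with Y expresses tr (P' - P)
    through R K - B^T P'. Replacing P' by P costs O(|H|^2), because P' is Lipschitz in H. *)
Lemma J2_grad (F : realType) n m (A : 'M[F]_n) (B : 'M[F]_(n, m))
    (Q : 'M[F]_n) (R : 'M[F]_m) K P Y :
  R^T = R -> possemidef Q -> stabilizing A B K -> lyap_solution A B Q R K P ->
  lyap_op (A - B *m K)^T Y = - 1%:M ->
  gradient (J2 A B Q R) K = 2 *: ((R *m K - B^T *m P) *m Y).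
Proof.
move=> RT [QT _] hK KP; have /lyap_solutionE[Pd MP] := KP.
have MI := hurwitz_inj hK; move: (MI) MP.
set M := A - B *m K => MI' MP MY.
have YT : Y^T = Y.
  by apply: lyap_sym (hurwitz_inj (hurwitz_trmx hK)) _; rewrite MY linearN /= trmx1.
set G := _ *: _.
have [C C0 MC] := lyap_inj_open MI.
have [e e0 Pe] := posdef_open Pd.
(* The Lipschitz constant of P' in H, valid for |H| <= 1. *)
pose c1 := C * (2 * l1norm R * l1norm K + l1norm R + 2 * l1norm B * l1norm P).
have c10 : 0 <= c1.
  by rewrite mulr_ge0 ?(ltW C0) // !addr_ge0 ?mulr_ge0.
(* For |H| < 1/q the three terms give respectively |H| <= 1, the uniform inverse bound for M', and
   c1 |H| < e, hence definiteness of P'. *)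
pose q := 1 + C * l1norm B + c1 / e.
have CB0 : 0 <= C * l1norm B by rewrite mulr_ge0 // ltW.
have c1e0 : 0 <= c1 / e by rewrite divr_ge0 // ltW.
have q0 : 0 < q by rewrite /q; lra.
apply: gradient_eq.
apply: (@is_gradient_quad _ _ _ _ _ _
  (2 * l1norm B * c1 * l1norm Y + l1norm R * l1norm Y) q^-1).
  by rewrite invr_gt0.
move=> H; rewrite -[q^-1]div1r ltr_pdivlMr // => Hq.
have h0 : 0 <= l1norm H by [].
have HE : l1norm H * q = l1norm H + l1norm H * (C * l1norm B) + l1norm H * (c1 / e).
  by rewrite /q; ring.
have h1 : 0 <= l1norm H * (C * l1norm B) by rewrite mulr_ge0.
have h2 : 0 <= l1norm H * (c1 / e) by rewrite mulr_ge0.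
have H1 : l1norm H <= 1 by lra.
have He : c1 * l1norm H < e.
  have : l1norm H * (c1 / e) < 1 by lra.
  by rewrite mulrA ltr_pdivrMr // mul1r mulrC.
pose M' := A - B *m (K + H).
have M'M : M' = M - B *m H by rewrite /M' mulmxDr opprD addrA.
have M'N : l1norm (M' - M) <= l1norm B * l1norm H.
  by rewrite M'M addrC addKr l1normN ler_l1normM.
have M'C : forall X, l1norm X <= C * l1norm (lyap_op M' X).
  apply: MC; apply: (@le_trans _ _ (C * (l1norm B * l1norm H))).
    by rewrite ler_pM2l.
  by rewrite mulrA mulrC; lra.
have M'I : lyap_inj M'.
  by move=> X M'X; apply: l1norm_le0; rewrite (le_trans (M'C X)) // M'X l1norm0 mulr0.
have [P' MP'] := lyap_onto (- stage_cost Q R (K + H)) M'I.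
have WT L : (stage_cost Q R L)^T = stage_cost Q R L.
  by rewrite /stage_cost linearD /= !trmx_mul trmxK QT RT mulmxA.
have P'T : P'^T = P' by apply: lyap_sym M'I _; rewrite MP' linearN /= WT.
have WE : stage_cost Q R (K + H) - stage_cost Q R K =
    H^T *m R *m K + K^T *m R *m H + H^T *m R *m H.
  rewrite /stage_cost [(K + H)^T]linearD /= !mulmxDl !mulmxDr.
  by apply/matrixP => i j; rewrite ![fun_of_matrix (_ + _) _ _]mxE
    ![fun_of_matrix (- _) _ _]mxE ![fun_of_matrix (_ + _) _ _]mxE; ring.
have P'P : l1norm (P' - P) <= c1 * l1norm H.
  apply: le_trans (lyap_perturb M P P' M'C C0) _.
  rewrite /c1 -[leRHS]mulrA ler_pM2l // MP' MP -opprD l1normN WE.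
  have t1 : l1norm (H^T *m R *m K) <= l1norm H * l1norm R * l1norm K.
    apply: le_trans (ler_l1normM _ _) _; rewrite ler_wpM2r //.
    by rewrite -(l1norm_tr H) ler_l1normM.
  have t2 : l1norm (K^T *m R *m H) <= l1norm K * l1norm R * l1norm H.
    apply: le_trans (ler_l1normM _ _) _; rewrite ler_wpM2r //.
    by rewrite -(l1norm_tr K) ler_l1normM.
  have t3 : l1norm (H^T *m R *m H) <= l1norm R * l1norm H.
    apply: (@le_trans _ _ (l1norm H * l1norm R * l1norm H)).
      apply: le_trans (ler_l1normM _ _) _; rewrite ler_wpM2r //.
      by rewrite -(l1norm_tr H) ler_l1normM.
    by rewrite ler_wpM2r // ler_piMl.
  have t4 : l1norm (M' - M) * l1norm P <= l1norm B * l1norm H * l1norm P.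
    by rewrite ler_wpM2r.
  have t5 := ler_l1normD (H^T *m R *m K + K^T *m R *m H) (H^T *m R *m H).
  have t6 := ler_l1normD (H^T *m R *m K) (K^T *m R *m H).
  lra.
have P'S : lyap_solution A B Q R (K + H) P'.
  by apply/lyap_solutionE; split=> //; apply: Pe => //; apply: le_lt_trans P'P He.
(* Injectivity of L_{M'} identifies the cost at K + H with tr P' before K + H is known to be
   stabilizing. *)
rewrite /J2 (lyap_P_eq M'I P'S) (lyap_P_eq MI KP) -linearB /=.
have trP : \tr (P' - P) = \tr ((H^T *m (R *m K - B^T *m P') +
    (H^T *m (R *m K - B^T *m P'))^T + H^T *m R *m H) *m Y).
  apply: (mxtrace_lyap (M := M)) MY.
  have MH : lyap_op M P' = lyap_op M' P' + lyap_op (B *m H) P'.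
    by rewrite M'M (lyap_opB M) subrK.
  rewrite [lyap_op M (P' - P)]linearB /= MP MH MP' /lyap_op !mulmxBr.
  rewrite [(_ - _)^T]linearB /=.
  rewrite !trmx_mul !trmxK RT P'T !mulmxA.
  move/matrixP: WE => WE; apply/matrixP => i j; have := WE i j.
  do ?rewrite ?[fun_of_matrix (_ + _) _ _]mxE ?[fun_of_matrix (- _) _ _]mxE.
  lra.
have trE : \tr (P' - P) = 2 * \tr (H^T *m (R *m K - B^T *m P') *m Y) +
    \tr (H^T *m R *m H *m Y).
  rewrite trP; move: (R *m K - B^T *m P') => Z.
  rewrite !mulmxDl !linearD /= mulr_natl mulr2n; congr (_ + _ + _).
  by rewrite -[LHS]mxtrace_tr [in LHS]trmx_mul trmxK YT mxtrace_mulC.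
have -> : \tr (P' - P) - frob_inner G H =
  - (2 * \tr (H^T *m B^T *m (P' - P) *m Y)) + \tr (H^T *m R *m H *m Y).
  rewrite trE.
  have -> : frob_inner G H = 2 * \tr (H^T *m (R *m K - B^T *m P) *m Y).
    rewrite /frob_inner -mxtrace_tr trmx_mul trmxK /G -scalemxAr linearZ /=.
    by rewrite mulmxA.
  by rewrite !(mulmxBr, mulmxBl) !mulmxA ![\tr (_ - _)]linearB /=; ring.
apply: le_trans (ler_normD _ _) _; rewrite normrN normrM ger0_norm // [leRHS]mulrDl.
apply: lerD.
  apply: (@le_trans _ _ (2 * (l1norm H * l1norm B * (c1 * l1norm H) * l1norm Y))).
    rewrite ler_wpM2l // (le_trans (ler_mxtrace_l1norm _)) //.
    apply: le_trans (ler_l1normM _ _) _; rewrite ler_wpM2r //.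
    apply: le_trans (ler_l1normM _ _) _; apply: ler_pM => //.
    by rewrite -(l1norm_tr H) -(l1norm_tr B) ler_l1normM.
  by rewrite le_eqVlt; apply/orP; left; apply/eqP; ring.
apply: le_trans (ler_mxtrace_l1norm _) _.
apply: (@le_trans _ _ (l1norm H * l1norm R * l1norm H * l1norm Y)).
  apply: le_trans (ler_l1normM _ _) _; rewrite ler_wpM2r //.
  apply: le_trans (ler_l1normM _ _) _; rewrite ler_wpM2r //.
  by rewrite -(l1norm_tr H) ler_l1normM.
by rewrite le_eqVlt; apply/orP; left; apply/eqP; ring.
Qed.

(** * Gradient dominance *)

Lemma mulmx_opt_gain (F : realType) n m (B : 'M[F]_(n, m)) (R : 'M[F]_m) P :
  posdef R -> R *m opt_gain B R P = B^T *m P.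
Proof. by move=> /posdef_unitmx Ru; rewrite /opt_gain -mulmxA mulKVmx. Qed.

(** Since R K = B^T P, the terms K^T B^T P and K^T R K cancel in the closed-loop equation, and P B K
    is the quadratic term of the Riccati equation. *)
Lemma opt_gain_lyap_solution (F : realType) n m (A : 'M[F]_n) (B : 'M[F]_(n, m))
    (Q : 'M[F]_n) (R : 'M[F]_m) P :
  posdef R -> are_solution A B Q R P ->
  lyap_solution A B Q R (opt_gain B R P) P.
Proof.
move=> Rd [Pd AP]; split=> //; rewrite -AP.
have RK := mulmx_opt_gain B P Rd; set K := opt_gain B R P in RK *.
have KR : K^T *m R = P *m B.
  by have := congr1 trmx RK; rewrite !trmx_mul trmxK Pd.1 Rd.1.
have -> : P *m B *m invmx R *m B^T *m P = P *m B *m K by rewrite /K /opt_gain !mulmxA.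
rewrite [(A - _)^T]linearB /= trmx_mul mulmxBl mulmxBr -[K^T *m B^T *m P]mulmxA.
rewrite -RK !mulmxA KR.
apply/matrixP => i j.
do ?rewrite ?[fun_of_matrix (_ + _) _ _]mxE ?[fun_of_matrix (- _) _ _]mxE.
ring.
Qed.

(** R Ks = B^T Ps cancels the terms linear in Ks - K and leaves a pure square. For stabilizing K and
    definite R this makes P - Ps semidefinite. *)
Lemma lyap_op_gap (F : realType) n m (A : 'M[F]_n) (B : 'M[F]_(n, m))
    (Q : 'M[F]_n) (R : 'M[F]_m) (Ks K : 'M[F]_(m, n)) Ps P :
  R^T = R -> Ps^T = Ps -> R *m Ks = B^T *m Ps ->
  lyap_op (A - B *m Ks) Ps = - stage_cost Q R Ks ->
  lyap_op (A - B *m K) P = - stage_cost Q R K ->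
  lyap_op (A - B *m K) (P - Ps) = - ((Ks - K)^T *m R *m (Ks - K)).
Proof.
move=> RT PsT RKs MPs MP.
have KsR : Ks^T *m R = Ps *m B.
  by have := congr1 trmx RKs; rewrite !trmx_mul trmxK PsT RT.
have -> : lyap_op (A - B *m K) (P - Ps) =
    lyap_op (A - B *m K) P - lyap_op (A - B *m K) Ps by rewrite linearB.
have -> : lyap_op (A - B *m K) Ps =
    lyap_op (A - B *m Ks) Ps + lyap_op (B *m (Ks - K)) Ps.
  by rewrite mulmxBr !lyap_opB addrA subrK.
rewrite MP MPs /lyap_op /stage_cost.
have -> : (Ks - K)^T = Ks^T - K^T by rewrite linearB.
have -> : (B *m (Ks - K))^T = (Ks^T - K^T) *m B^T by rewrite trmx_mul linearB.
rewrite !(mulmxBr, mulmxBl) -!mulmxA -RKs !mulmxA -KsR.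
apply/matrixP => i j.
do ?rewrite ?[fun_of_matrix (_ + _) _ _]mxE ?[fun_of_matrix (- _) _ _]mxE.
ring.
Qed.

(** The same gap seen through the fixed matrix A - B Ks, whose inverse bound does not depend on K. E
    enters through B^T (P - Ps) = - E - R (Ks - K). *)
Lemma lyap_op_gap_opt (F : realType) n m (A : 'M[F]_n) (B : 'M[F]_(n, m))
    (R : 'M[F]_m) (Ks K E : 'M[F]_(m, n)) Ps P :
  R^T = R -> P^T = P -> Ps^T = Ps -> R *m Ks = B^T *m Ps ->
  E = R *m K - B^T *m P ->
  lyap_op (A - B *m K) (P - Ps) = - ((Ks - K)^T *m R *m (Ks - K)) ->
  lyap_op (A - B *m Ks) (P - Ps) =
  (Ks - K)^T *m E + E^T *m (Ks - K) + (Ks - K)^T *m R *m (Ks - K).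
Proof.
move=> RT PT PsT RKs EE MX.
have XT : (P - Ps)^T = P - Ps by rewrite linearB /= PT PsT.
have -> : lyap_op (A - B *m Ks) (P - Ps) =
    lyap_op (A - B *m K) (P - Ps) - lyap_op (B *m (Ks - K)) (P - Ps).
  by rewrite mulmxBr !lyap_opB opprB addrA subrK.
have BX : B^T *m (P - Ps) = - E - R *m (Ks - K).
  rewrite EE !mulmxBr -RKs; apply/matrixP => i j.
  do ?rewrite ?[fun_of_matrix (_ + _) _ _]mxE ?[fun_of_matrix (- _) _ _]mxE; ring.
have XB : (P - Ps) *m B = - E^T - (Ks - K)^T *m R.
  have := congr1 trmx BX; rewrite trmx_mul trmxK XT => ->.
  have -> : (- E - R *m (Ks - K))^T = - E^T - (R *m (Ks - K))^T.
    by rewrite linearB /= linearN.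
  by rewrite trmx_mul RT.
rewrite MX /lyap_op trmx_mul -[_ *m B^T *m _]mulmxA BX (mulmxA (P - Ps)) XB.
rewrite (mulmxBr _ (- E)) (mulmxBl (- E^T)) !mulmxN mulNmx !mulmxA.
apply/matrixP => i j.
do ?rewrite ?[fun_of_matrix (_ + _) _ _]mxE ?[fun_of_matrix (- _) _ _]mxE.
ring.
Qed.

(** Multiplying by r and using (r t - 2 e)^2 >= 0 to absorb the cross term gives t^2 <= k e^2; the
    factor 1 + k replaces the square root of k. *)
Lemma quad_bound (F : realFieldType) (r g t e : F) :
  0 < r -> 0 <= g -> 0 <= t -> 0 <= e -> r * t ^+ 2 <= g * e ^+ 2 + 2 * t * e ->
  t <= (1 + 2 / r * (g + 2 / r)) * e.
Proof.
move=> r0 g0 t0 e0 H; pose k := 2 / r * (g + 2 / r).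
have ri0 : 0 < r^-1 by rewrite invr_gt0.
have k0 : 0 <= k by rewrite /k !(mulr_ge0, addr_ge0) // ltW.
rewrite -/k -(@ler_pXn2r _ 2) ?nnegrE //; last by rewrite mulr_ge0 // addr_ge0.
have kr : k * r ^+ 2 = 2 * r * g + 4 by rewrite /k; field; rewrite gt_eqF.
have H2 : r ^+ 2 * t ^+ 2 <= (k * r ^+ 2) * e ^+ 2.
  have := ler_wpM2l (ltW r0) H; have := sqr_ge0 (r * t - 2 * e).
  rewrite kr; lra.
have {}H2 : t ^+ 2 <= k * e ^+ 2.
  by rewrite -(@ler_pM2l _ (r ^+ 2)) ?exprn_gt0 //; lra.
rewrite exprMn (le_trans H2) // ler_wpM2r ?sqr_ge0 //.
have := sqr_ge0 k; lra.
Qed.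

(* The dual equation turns E E^T into - E (M Y + Y M^T) E^T. *)
Lemma grad_factor_bound (F : realType) n m (M Y : 'M[F]_n) (E : 'M[F]_(m, n)) :
  Y^T = Y -> lyap_op M^T Y = - 1%:M ->
  \tr (E^T *m 1%:M *m E) <= l1norm E * l1norm M * l1norm (2 *: (E *m Y)).
Proof.
move=> YT MY; rewrite mulmx1 mxtrace_mulC.
have -> : \tr (E *m E^T) = - \tr (E *m M *m (2 *: (E *m Y))^T).
  rewrite -{1}[E]mulmx1 -[1%:M]opprK -MY /lyap_op trmxK.
  rewrite mulmxN mulNmx linearN /= mulmxDr mulmxDl linearD /=.
  have -> : \tr (E *m (Y *m M^T) *m E^T) = \tr (E *m (M *m Y) *m E^T).
    by rewrite -mxtrace_tr !trmx_mul !trmxK YT !mulmxA.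
  rewrite linearZ /= -scalemxAr linearZ /= trmx_mul YT !mulmxA.
  by rewrite mulr_natl mulr2n.
apply: le_trans (ler_norm _) _; rewrite normrN.
apply: le_trans (ler_mxtrace_l1norm _) _.
apply: le_trans (ler_l1normM _ _) _; rewrite l1norm_tr ler_wpM2r //.
exact: ler_l1normM.
Qed.

Lemma ler_l1norm_frob_norm (F : realType) m n (M : 'M[F]_(m, n)) :
  l1norm M <= (m * n)%:R * frob_norm M.
Proof.
apply: ler_l1norm_bound => i j; rewrite /frob_norm -sqrtr_sqr ler_wsqrtr //.
rewrite /frob_inner /mxtrace (bigD1 j) //= mxE (bigD1 i) //= mxE -expr2 -addrA lerDl.
apply: addr_ge0; apply: sumr_ge0 => k _; first by rewrite mxE -expr2 sqr_ge0.
by rewrite mxE; apply: sumr_ge0 => l _; rewrite mxE -expr2 sqr_ge0.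
Qed.

(** With s = sqrt (k x) this is c s / (a + b s), which increases because the products of the two
    square roots cancel in cross-multiplication; it saturates at c / b. *)
Lemma class_K_saturating_sqrt (F : realType) (c k a b : F) :
  0 < c -> 0 < k -> 0 < a -> 0 < b ->
  class_K (fun x => c * Num.sqrt (k * x) / (a + b * Num.sqrt (k * x))).
Proof.
move=> c0 k0 a0 b0.
have s0 x : 0 <= Num.sqrt (k * x) by exact: sqrtr_ge0.
have d0 x : 0 < a + b * Num.sqrt (k * x) by rewrite ltr_pwDl // mulr_ge0 // ltW.
split.
- by move=> x _; rewrite divr_ge0 ?mulr_ge0 // ltW.
- apply: continuous_subspaceT => x.
  have sc : (Num.sqrt (k * y) @[y --> x] --> Num.sqrt (k * x))%classic.
    apply: (@continuous_comp _ _ _ (fun y => k * y) Num.sqrt).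
      by apply: cvgM; [exact: cvg_cst|exact: cvg_id].
    exact: sqrt_continuous.
  apply: cvgM; first by apply: cvgM => //; exact: cvg_cst.
  apply: cvgV; first by rewrite gt_eqF.
  by apply: cvgD; [exact: cvg_cst|apply: cvgM => //; exact: cvg_cst].
- move=> x y x0 xy; rewrite ltr_pdivrMr // mulrAC ltr_pdivlMr //.
  have : Num.sqrt (k * x) < Num.sqrt (k * y).
    by rewrite ltr_sqrt ?ltr_pM2l // mulr_gt0 // (le_lt_trans x0).
  move: (Num.sqrt (k * x)) (Num.sqrt (k * y)) => s t st.
  have : c * a * s < c * a * t by rewrite ltr_pM2l // mulr_gt0.
  lra.
- by rewrite mulr0 sqrtr0 mulr0 mul0r.
Qed.

Theorem lemma5p7 (F : realType) (n m : nat)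
    (A : 'M[F]_n) (B : 'M[F]_(n, m)) (Q : 'M[F]_n) (R : 'M[F]_m)
    (sqrtQ Pstar : 'M[F]_n)
    (hQ : possemidef Q) (hR : posdef R)
    (hAB : stabilizable A B)
    (hsqrtQ : possemidef sqrtQ) (hsqrtQ2 : sqrtQ *m sqrtQ = Q)
    (hAQ : observable A sqrtQ)
    (hPstar : are_solution A B Q R Pstar) :
  exists xi1 : F -> F, class_K xi1 /\
    forall K : 'M[F]_(m, n), stabilizing A B K ->
      xi1 (J2 A B Q R K - J2 A B Q R (opt_gain B R Pstar))
        <= frob_norm (gradient (J2 A B Q R) K).
Proof.
set Ks := opt_gain B R Pstar.
have RT := hR.1; have PsT := hPstar.1.1.
have RKs : R *m Ks = B^T *m Pstar := mulmx_opt_gain B Pstar hR.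
have KsS : lyap_solution A B Q R Ks Pstar := opt_gain_lyap_solution hR hPstar.
have hKs := lyap_solution_stabilizing hQ hR hsqrtQ hsqrtQ2 hAQ KsS.
have MsI := hurwitz_inj hKs; have MPs := (lyap_solutionE A B Q R Ks Pstar).1 KsS.
pose Ms := A - B *m Ks.
have [[C C0 MsC] _] := @linear_inj_bounded _ _ _ (lyap_op Ms) MsI.
have [r r0 Rr] := posdef_coercive n hR.
have [i i0 Ii] := posdef_coercive n (posdef1 F m).
(* The constant of tr X <= c1 |E|^2; the added 1 allows dividing by it in the witness. *)
pose c1 := C * l1norm (invmx R) + 1.
have c10 : 0 < c1 by rewrite ltr_wpDl // mulr_ge0 // ltW.
pose g := 2 * l1norm Ms * ((n * n)%:R * c1).
have g0 : 0 <= g by rewrite !mulr_ge0 // ltW.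
pose b1 := 1 + 2 / r * (g + 2 / r).
have b10 : 0 <= b1.
  by rewrite addr_ge0 // mulr_ge0 ?addr_ge0 ?divr_ge0 // ltW.
pose N : F := (m * n)%:R + 1; have N0 : 0 < N by rewrite ltr_wpDl.
pose a := (l1norm Ms + 1) * N; pose b := (l1norm B * b1 + 1) * N.
have a0 : 0 < a by rewrite mulr_gt0 // ltr_wpDl.
have b0 : 0 < b by rewrite mulr_gt0 // ltr_wpDl // mulr_ge0.
(* The lower bound i |E| / (a + b |E|) on the gradient, with |E| replaced by its lower bound sqrt
   (tr X / c1). *)
exists (fun x => i * Num.sqrt (c1^-1 * x) / (a + b * Num.sqrt (c1^-1 * x))).
split=> [|K hK]; first by apply: class_K_saturating_sqrt; rewrite ?invr_gt0.
have [P KP] := lyap_solution_exists hQ hR hsqrtQ hsqrtQ2 hAQ hK.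
have MI := hurwitz_inj hK; have [Pd MP] := (lyap_solutionE A B Q R K P).1 KP.
have hMT := hurwitz_trmx hK.
have [Y MY] := lyap_onto (- 1%:M) (hurwitz_inj hMT).
have YT : Y^T = Y by apply: lyap_sym (hurwitz_inj hMT) _; rewrite MY linearN /= trmx1.
rewrite (J2_grad RT hQ hK KP MY) /J2 (lyap_P_eq MI KP) (lyap_P_eq MsI KsS) -linearB /=.
set E := R *m K - B^T *m P; set X := P - Pstar; pose D := Ks - K.
have MX := lyap_op_gap RT PsT RKs MPs.2 MP.
have MsX := lyap_op_gap_opt RT Pd.1 PsT RKs (erefl E) MX.
rewrite -/X -/D -/Ms in MX MsX.
have Xp : possemidef X := lyap_possemidef hK (possemidef_congr D (posdefW hR)) MX.
have Ru := posdef_unitmx hR.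
have e0 : 0 <= l1norm E by [].
have trX0 := possemidef_mxtrace_ge0 Xp.
have trX : \tr X <= c1 * l1norm E ^+ 2.
  (* [Z] majorizes X: by completing the square, Z - X solves the equation of the optimal gain with
     the data - (D + R^-1 E)^T R (D + R^-1 E). The size of [Z] is quadratic in E. *)
  have [Z MZ] := lyap_onto (- (E^T *m invmx R *m E)) MsI.
  have ZXp : possemidef (Z - X).
    pose S := (D + invmx R *m E)^T *m R *m (D + invmx R *m E).
    have Sp : possemidef S by exact/possemidef_congr/posdefW.
    apply: (lyap_possemidef hKs Sp).
    rewrite [LHS]linearB /= -/Ms MZ MsX -opprD; congr (- _).
    rewrite /S [(D + _)^T]linearD /= trmx_mul trmx_inv RT mulmxDl.
    rewrite (mulmxKV Ru) !mulmxDl !mulmxDr !mulmxA (mulmxK Ru).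
    apply/matrixP => k l.
    by do ?rewrite [fun_of_matrix (_ + _) _ _]mxE; ring.
  have := possemidef_mxtrace_ge0 ZXp; rewrite linearB /= subr_ge0 => /le_trans -> //.
  apply: le_trans (ler_norm _) _; apply: le_trans (ler_mxtrace_l1norm _) _.
  apply: le_trans (MsC Z) _; rewrite /= MZ l1normN.
  have : l1norm (E^T *m invmx R *m E) <= l1norm (invmx R) * l1norm E ^+ 2.
    apply: le_trans (ler_l1normM _ _) _; rewrite expr2 mulrA ler_wpM2r //.
    by rewrite mulrC -(l1norm_tr E) ler_l1normM.
  move=> /(ler_wpM2l (ltW C0)) /le_trans -> //.
  by rewrite mulrA ler_wpM2r ?sqr_ge0 // lerDl.
have DE : l1norm D <= b1 * l1norm E.
  apply: quad_bound => //; apply: le_trans (Rr D) _.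
  (* The trace of the identity for L_{Ms} X isolates the [R]-form of D, whose coercivity yields the
     inequality of [quad_bound]. *)
  have -> : \tr (D^T *m R *m D) = \tr (lyap_op Ms X) - 2 * \tr (D^T *m E).
    rewrite MsX [\tr (_ + _)]linearD /= [\tr (_ + _)]linearD /=.
    by rewrite -[\tr (E^T *m D)]mxtrace_tr trmx_mul trmxK; ring.
  have t1 : \tr (lyap_op Ms X) <= g * l1norm E ^+ 2.
    apply: le_trans (ler_norm _) _; apply: le_trans (ler_mxtrace_l1norm _) _.
    apply: le_trans (ler_l1norm_lyap_op _ _) _; rewrite -!mulrA.
    rewrite ler_wpM2l // ler_wpM2l // (le_trans (possemidef_l1norm_mxtrace Xp)) //.
    by rewrite ler_wpM2l.
  have t2 : - \tr (D^T *m E) <= l1norm D * l1norm E.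
    apply: le_trans (ler_norm _) _; rewrite normrN.
    apply: le_trans (ler_mxtrace_l1norm _) _.
    by rewrite -(l1norm_tr D) ler_l1normM.
  lra.
have MN : l1norm (A - B *m K) <= l1norm Ms + l1norm B * b1 * l1norm E.
  have -> : A - B *m K = Ms + B *m D by rewrite mulmxBr addrA subrK.
  apply: le_trans (ler_l1normD _ _) _; rewrite lerD2l.
  apply: le_trans (ler_l1normM _ _) _.
  by rewrite -mulrA ler_wpM2l.
have f0 : 0 <= frob_norm (2 *: (E *m Y)) by exact: sqrtr_ge0.
have EG : i * l1norm E <= (a + b * l1norm E) * frob_norm (2 *: (E *m Y)).
  have G1 : i * l1norm E <= l1norm (A - B *m K) * l1norm (2 *: (E *m Y)).
    (* Coercivity and [grad_factor_bound] both carry a factor |E|, which is cancelled when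
       nonzero. *)
    have [E0|EN0] := eqVneq (l1norm E) 0; first by rewrite E0 mulr0 mulr_ge0.
    have Ep : 0 < l1norm E by rewrite lt0r EN0.
    rewrite -(ler_pM2l Ep) [leLHS]mulrCA [leRHS]mulrA.
    by apply: le_trans (Ii E) _; exact: grad_factor_bound.
  apply: le_trans G1 _.
  apply: (@le_trans _ _ ((l1norm Ms + l1norm B * b1 * l1norm E) *
      (N * frob_norm (2 *: (E *m Y))))).
    apply: ler_pM => //; apply: le_trans (ler_l1norm_frob_norm _) _.
    by rewrite ler_wpM2r // lerDl.
  rewrite mulrA ler_wpM2r // /a /b.
  have := mulr_ge0 e0 (ltW N0); lra.
set s := Num.sqrt _; have s0 : 0 <= s by exact: sqrtr_ge0.
have sE : s <= l1norm E.
  rewrite -(ger0_norm e0) -sqrtr_sqr ler_wsqrtr // mulrC ler_pdivrMr // mulrC.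
  exact: trX.
have den x : 0 <= x -> 0 < a + b * x by move=> x0; rewrite ltr_pwDl // mulr_ge0 // ltW.
apply: (@le_trans _ _ (i * l1norm E / (a + b * l1norm E))).
  rewrite ler_pdivrMr ?den // mulrAC ler_pdivlMr ?den //.
  have : i * a * s <= i * a * l1norm E by rewrite ler_wpM2l // mulr_ge0 // ltW.
  lra.
by rewrite ler_pdivrMr ?den // [leRHS]mulrC.
Qed.
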